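(* Let $d\le n$ be integers, and let $\mathcal{F}$ be a uniform family of subsets of $[n]=\{1,\dots,n\}$ (i.e. there is an integer $k$ with $|F|=k$ for every $F\in\mathcal{F}$) such that $\operatorname{Vdim}(\mathcal{F}\,\Delta\,\mathcal{F})\le d$. Then \[ |\mathcal{F}|\le 2\binom{n}{\lfloor d/2\rfloor}. \]
   Context: For families $\mathcal{F},\mathcal{G}$ of subsets of $[n]$, $\mathcal{F}\,\Delta\,\mathcal{G}:=\{A\,\Delta\, B:\ A\in\mathcal{F},\ B\in\mathcal{G}\}$, where $A\,\Delta\,B$ is the symmetric difference of sets. A family $\mathcal{F}$ shatters $M\subseteq[n]$ if $\{F\cap M: F\in\mathcal{F}\}=2^M$ (all subsets of $M$). The VC-dimension $\operatorname{Vdim}(\mathcal{F})$ is the maximum size of a set shattered by $\mathcal{F}$. *)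

(* Defs.v *)
From mathcomp Require Import all_boot.

Set Implicit Arguments.
Unset Strict Implicit.
Unset Printing Implicit Defensive.

Definition symdiff (T : finType) (A B : {set T}) : {set T} :=
  (A :\: B) :|: (B :\: A).

(* Elementwise symmetric difference of families, not the symmetric difference
   of F and G as sets of sets. *)
Definition symdiff_family (T : finType) (F G : {set {set T}}) : {set {set T}} :=
  [set symdiff A B | A in F, B in G].

Definition shatters (T : finType) (F : {set {set T}}) (M : {set T}) : bool :=
  [set A :&: M | A in F] == powerset M.

(* The empty family shatters nothing and gets Vdim 0; every nonempty family
   shatters set0. *)
Definition Vdim (T : finType) (F : {set {set T}}) : nat :=
  \max_(M : {set T} | shatters F M) #|M|.

Definition uniform_family (T : finType) (F : {set {set T}}) : Prop :=
  exists k : nat, forall A : {set T}, A \in F -> #|A| = k.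

(* Main.v *)
(** Write [x^S A] for the monomial taking the value [[S \subset A]].  If [H]
    does not shatter [S], some pattern [X] on [S] is missed by [H], so the
    product over [i \in S] of the factors [x_i - [i \notin X]] vanishes on [H]
    and expresses [x^S] through proper subsets of [S].  Hence on
    [H = F \Delta F] the function [prod_i (x_i - 1)], which is a sign at the
    empty set and zero elsewhere, is an integer combination [f] of monomials of
    degree at most [d].

    As in the Croot-Lev-Pach method, consider the integer matrix with entries
    [f (1_A + 1_B)], for [A], [B] in [F].  Modulo 2, [1_A + 1_B] is the indicator of
    [A \Delta B], so this matrix is congruent to the identity, its determinant is
    odd, and its rational rank is [#|F|].  On the other hand, each monomial in the
    expansion has degree at most [d./2] in [A] or in [B], and on [k]-sets with
    [d./2 <= k] such monomials lie in the rational span of those of degree exactly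
    [d./2].  This bounds the rank by [2 * 'C(n, d./2)].  If [k < d./2], already
    ['C(n, k)] is small enough. *)

Require Import Defs.
From mathcomp Require Import all_boot all_order all_algebra zify.

Import GRing.Theory.

(** * Reducing monomials on a family of bounded VC-dimension *)

Section Monomials.

Local Open Scope ring_scope.

Variables (R : comNzRingType) (T : finType).
Implicit Types (S A J : {set T}) (H : {set {set T}}) (g : {set T} -> R).

Lemma prodrD_subsets (f h : T -> R) S :
  \prod_(i in S) (f i + h i)
  = \sum_(J : {set T} | J \subset S)
      (\prod_(i in J) f i) * \prod_(i in S :\: J) h i.
Proof.
(* Off [S] each factor becomes [0 + 1], so expanding over all of [T] kills every [J] not inside
   [S]. *)
pose f' i := if i \in S then f i else 0.
pose h' i := if i \in S then h i else 1.
rewrite big_mkcond /= (eq_bigr (fun i => f' i + h' i)); last first.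
  by move=> i _; rewrite /f' /h'; case: (i \in S); rewrite ?add0r.
rewrite bigA_distr [RHS]big_mkcond; apply: eq_bigr => J _.
case: (boolP (J \subset S)) => [/subsetP sJS | /subsetPn[i iJ iS]].
  rewrite [X in _ = X * _]big_mkcond [X in _ = _ * X]big_mkcond -big_split /=.
  apply: eq_bigr => i _; rewrite /f' /h' inE.
  case: (boolP (i \in J)) => [/sJS -> | _]; first by rewrite mulr1.
  by case: ifP; rewrite mul1r.
by rewrite (bigD1 i) //= iJ /f' (negbTE iS) mul0r.
Qed.

Definition mono S A : R := (S \subset A)%:R.

Lemma monoE S A : mono S A = \prod_(i in S) (i \in A)%:R.
Proof.
rewrite /mono; case: (boolP (S \subset A)) => [/subsetP sSA | /subsetPn[i iS iA]].
  by rewrite big1 // => i /sSA ->.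
by rewrite (bigD1 i) //= (negbTE iA) mul0r.
Qed.

(** The coefficients stay in [R]: for [R := int] they can be reduced modulo 2 and also read in
    [rat]. *)
Definition spanned d H g :=
  exists c : {set T} -> R,
    forall A, A \in H -> g A = \sum_(S : {set T} | (#|S| <= d)%N) c S * mono S A.

Lemma spanned_sum d H (P : pred {set T}) (a : {set T} -> R)
    (g : {set T} -> {set T} -> R) :
    (forall J, P J -> spanned d H (g J)) ->
  spanned d H (fun A => \sum_(J | P J) a J * g J A).
Proof.
move=> gP.
have /fin_all_exists[c cP] J : exists c : {set T} -> R, P J ->
    forall A, A \in H -> g J A = \sum_(S : {set T} | (#|S| <= d)%N) c S * mono S A.
  case: (boolP (P J)) => [/gP[c cP] | _]; first by exists c.
  by exists (fun=> 0).
exists (fun S => \sum_(J | P J) a J * c J S) => A HA.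
under [RHS]eq_bigr do rewrite mulr_suml.
rewrite exchange_big; apply: eq_bigr => J PJ.
rewrite (cP _ PJ _ HA) mulr_sumr.
by apply: eq_bigr => S _; rewrite mulrA.
Qed.

Lemma not_shatters_Vdim H S : (Vdim H < #|S|)%N -> ~~ shatters H S.
Proof.
by rewrite ltnNge; apply: contra => sHS; apply: (leq_bigmax_cond S).
Qed.

Lemma mono_spanned d H S : (Vdim H <= d)%N -> spanned d H (mono S).
Proof.
move=> Hd; have [m] := ubnP #|S|; elim: m S => // m IHm S /ltnSE leSm.
case: (leqP #|S| d) => [leSd | ltdS].
  exists (fun J => (J == S)%:R) => A _.
  rewrite (bigD1 S) //= eqxx mul1r big1 ?addr0 // => J /andP[_ /negbTE ->].
  by rewrite mul0r.
have: ~~ ([set A :&: S | A in H] == powerset S).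
  by apply: not_shatters_Vdim; apply: leq_ltn_trans ltdS.
rewrite eqEsubset negb_and => /orP[/subsetPn[X /imsetP[A _ ->]] | ].
  by rewrite inE subsetIr.
case/subsetPn => X; rewrite inE => sXS XnH.
(* The factor at [i] vanishes exactly when [A] and [X] disagree at [i]; if none vanished, [A :&: S]
   would be the missed pattern [X]. *)
pose b i : R := - (i \notin X)%:R.
have vanish A : A \in H -> \prod_(i in S) ((i \in A)%:R + b i) = 0.
  move=> HA; case: (boolP [exists i in S, (i \in A) == (i \notin X)]).
    by case/exists_inP=> i iS /eqP e; rewrite (bigD1 i) //= e subrr mul0r.
  move/exists_inPn => e; case/negP: XnH; apply/imsetP; exists A => //.
  apply/setP => i; rewrite inE.
  case: (boolP (i \in S)) => [/e | iS].
    by case: (i \in A); case: (i \in X).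
  by rewrite andbF; apply: contraNF iS; apply: (subsetP sXS).
have [c cP] : spanned d H (fun A => \sum_(J : {set T} | J \proper S)
    - (\prod_(i in S :\: J) b i) * mono J A).
  apply: spanned_sum => J pJS; apply: IHm.
  exact: leq_trans (proper_card pJS) leSm.
exists c => A HA; rewrite -cP //.
(* The top term [J = S] has coefficient 1, so [mono S] is isolated without division. *)
have := vanish A HA; rewrite prodrD_subsets (bigD1 S) //= -monoE setDv big_set0.
rewrite mulr1 => /eqP; rewrite addr_eq0 => /eqP ->.
rewrite -sumrN; apply: eq_big => [J | J _]; first by rewrite properEneq andbC.
by rewrite -monoE mulNr mulrC.
Qed.

Lemma prod_sub1_spanned d H : (Vdim H <= d)%N ->
  spanned d H (fun A => \prod_(i : T) ((i \in A)%:R - 1)).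
Proof.
move=> Hd.
have [c cP] : spanned d H (fun A => \sum_(J : {set T} | J \subset setT)
    (\prod_(i in setT :\: J) (-1)) * mono J A).
  by apply: spanned_sum => J _; apply: mono_spanned.
exists c => A HA; rewrite -cP //.
have -> : \prod_(i : T) ((i \in A)%:R - 1) =
    \prod_(i in [set: T]) ((i \in A)%:R - 1 : R).
  by apply: eq_bigl => i; rewrite inE.
rewrite prodrD_subsets; apply: eq_bigr => J _.
by rewrite -monoE mulrC.
Qed.

End Monomials.

Arguments mono {R T}.

(** * Monomials on [k]-sets *)

Section Slice.

Local Open Scope ring_scope.

Variables (T : finType) (N k t : nat) (A : 'I_N -> {set T}).
Hypotheses (Ak : forall i, #|A i| = k) (tk : (t <= k)%N).

Definition mono_row (S : {set T}) : 'rV[rat]_N :=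
  \row_j mono S (A j).

Let D := [set S : {set T} | #|S| == t].

Definition level_mx : 'M[rat]_(#|D|, N) :=
  \matrix_(i, j) mono (enum_val i) (A j).

Lemma mxrank_level : (\rank level_mx <= 'C(#|T|, t))%N.
Proof. by rewrite -card_draws; apply: rank_leq_row. Qed.

(** Double counting: a [k]-set containing [S] contains [i |: S] for exactly [k - #|S|] elements [i]
    outside [S]; on other sets both sides vanish. *)
Lemma mono_row_setU1 (S : {set T}) :
  \sum_(i : T | i \notin S) mono_row (i |: S) = (k - #|S|)%:R *: mono_row S.
Proof.
apply/rowP => j; rewrite summxE !mxE.
under eq_bigr do rewrite mxE /mono subUset sub1set.
rewrite /mono; case: (boolP (S \subset A j)) => [sSA | _]; last first.
  by rewrite mulr0 big1 // => i _; rewrite andbF.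
rewrite mulr1 -(Ak j) -cardsDS // -sum1_card natr_sum.
rewrite big_mkcond [RHS]big_mkcond; apply: eq_bigr => i _.
by rewrite inE andbT; case: (i \in S) => //=; case: (i \in A j).
Qed.

Lemma mono_row_level (S : {set T}) : (#|S| <= t)%N -> (mono_row S <= level_mx)%MS.
Proof.
have [m] := ubnP (t - #|S|)%N; elim: m S => // m IHm S /ltnSE leSm leSt.
have [eSt | neSt] := eqVneq #|S| t.
  have SD : S \in D by rewrite inE eSt.
  suff -> : mono_row S = row (enum_rank_in SD S) level_mx by apply: row_sub.
  by apply/rowP => j; rewrite !mxE enum_rankK_in.
have ltSt : (#|S| < t)%N by rewrite ltn_neqAle neSt.
(* Dividing by this number raises the degree by one; here [#|S| < t <= k] is used. *)
have nz : (k - #|S|)%:R != 0 :> rat.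
  by rewrite Num.Theory.pnatr_eq0 -lt0n subn_gt0 (leq_trans ltSt).
rewrite -[mono_row S](scalerK nz) -mono_row_setU1.
apply/scalemx_sub/summx_sub => i iS.
have cS : #|i |: S| = #|S|.+1 by rewrite cardsU1 iS.
apply: IHm; rewrite cS //.
by rewrite subnS; case: (t - #|S|)%N leSm (subn_gt0 #|S| t); rewrite ltSt.
Qed.

End Slice.

Lemma leq_bin2r n k t : k <= t -> t.*2 <= n -> 'C(n, k) <= 'C(n, t).
Proof.
move=> /subnKC <-; elim: (t - k) => [|m IHm]; first by rewrite addn0.
rewrite addnS => h; apply: leq_trans (IHm _) _.
  by apply: leq_trans h; rewrite leq_double.
(* What remains is [k + m + 1 <= n - (k + m)]. *)
rewrite -(leq_pmul2l (ltn0Sn (k + m))) mul_bin_left leq_mul2r; apply/orP; right.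
by move: h; lia.
Qed.

(** * Rank of the integer matrix, from below modulo 2 and from above over the rationals *)

Section Rank.

Local Open Scope ring_scope.

Lemma mxrank_int_id_mod2 (N : nat) (M : 'M[int]_N) :
    map_mx (intr : int -> 'F_2) M = 1%:M ->
  \rank (map_mx (intr : int -> rat) M) = N.
Proof.
move=> M1; apply: mxrank_unit; rewrite unitmxE unitfE det_map_mx intr_eq0.
apply/eqP => M0; have /eqP := congr1 determinant M1.
by rewrite det_map_mx M0 det1.
Qed.

Lemma symdiffE (T : finType) (A B : {set T}) i :
  (i \in symdiff A B) = (i \in A) (+) (i \in B).
Proof. by rewrite !inE; case: (i \in A); case: (i \in B). Qed.

Variables (T : finType) (N k d : nat) (A : 'I_N -> {set T}).
Hypotheses (Ak : forall i, #|A i| = k) (dk : (d./2 <= k)%N).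
Variable c : {set T} -> int.

Definition sum_mx : 'M[int]_N := \matrix_(i, j)
  \sum_(S : {set T} | (#|S| <= d)%N)
    c S * \prod_(x in S) ((x \in A i)%:R + (x \in A j)%:R).

Let mrow := mono_row T N A.
Let term S J := (c S)%:~R *: ((mrow J)^T *m mrow (S :\: J)).

(** Expanding the product over [S] separates [A i] from [A j], which makes each summand an outer
    product. *)
Lemma sum_mx_split : map_mx (intr : int -> rat) sum_mx =
  \sum_(S : {set T} | (#|S| <= d)%N)
    \sum_(J : {set T} | J \subset S) term S J.
Proof.
apply/matrixP => i j; rewrite !mxE summxE rmorph_sum; apply: eq_bigr => S _.
rewrite rmorphM /= prodrD_subsets rmorph_sum mulr_sumr summxE.
apply: eq_bigr => J _; rewrite -!monoE !mxE big_ord1 !mxE rmorphM /=.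
by rewrite /mono !rmorph_nat.
Qed.

Lemma rank_sum_mx :
  (\rank (map_mx (intr : int -> rat) sum_mx) <= 2 * 'C(#|T|, d./2))%N.
Proof.
pose L := level_mx T N d./2 A.
pose M1 := \sum_(S : {set T} | (#|S| <= d)%N)
  \sum_(J : {set T} | (J \subset S) && (#|J| <= d./2)%N) term S J.
pose M2 := \sum_(S : {set T} | (#|S| <= d)%N)
  \sum_(J : {set T} | (J \subset S) && ~~ (#|J| <= d./2)%N) term S J.
have -> : map_mx (intr : int -> rat) sum_mx = M1 + M2.
  rewrite sum_mx_split -big_split; apply: eq_bigr => S _ /=.
  exact: bigID.
(* In [M1] the low-degree monomial is the left factor, so it is the column space that lies in
   [L]. *)
have M1L : (M1^T <= L)%MS.
  rewrite linear_sum; apply: summx_sub => S _.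
  rewrite linear_sum; apply: summx_sub => J /andP[_ leJ].
  rewrite linearZ /= trmx_mul trmxK scalemx_sub //.
  by apply: submx_trans (submxMl _ _) _; apply: (mono_row_level _ _ k).
have M2L : (M2 <= L)%MS.
  apply: summx_sub => S leS; apply: summx_sub => J /andP[sJS]; rewrite -ltnNge => ltJ.
  apply/scalemx_sub/(submx_trans (submxMl _ _)).
  apply: (mono_row_level _ _ k) => //; rewrite cardsDS //.
  (* [#|S| - #|J| <= d - (d./2 + 1) <= d./2]. *)
  by move: leS ltJ; clear; lia.
have rL : (\rank L <= 'C(#|T|, d./2))%N by apply: mxrank_level.
apply: leq_trans (mxrank_add _ _) _; rewrite mul2n -addnn leq_add //.
  by rewrite -mxrank_tr; apply: leq_trans (mxrankS M1L) rL.
by apply: leq_trans (mxrankS M2L) rL.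
Qed.

Hypothesis Ainj : injective A.
Hypothesis cP : forall i j,
  \prod_(x : T) ((x \in symdiff (A i) (A j))%:R - 1)
  = \sum_(S : {set T} | (#|S| <= d)%N) c S * mono S (symdiff (A i) (A j)).

Lemma sum_mx_mod2 : map_mx (intr : int -> 'F_2) sum_mx = 1%:M.
Proof.
apply/matrixP => i j; rewrite !mxE.
have -> : (\sum_(S : {set T} | (#|S| <= d)%N) c S *
    \prod_(x in S) ((x \in A i)%:R + (x \in A j)%:R))%:~R =
    (\sum_(S : {set T} | (#|S| <= d)%N) c S * mono S (symdiff (A i) (A j)))%:~R :> 'F_2.
  rewrite !rmorph_sum; apply: eq_bigr => S _.
  rewrite !rmorphM /= monoE !rmorph_prod; congr (_ * _); apply: eq_bigr => x _.
  rewrite symdiffE rmorphD !rmorph_nat /=.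
  by case: (x \in A i); case: (x \in A j) => //=; apply/val_inj.
(* On the diagonal every factor is [-1], which is 1 modulo 2; elsewhere a point of the symmetric
   difference gives a zero factor. *)
rewrite -cP rmorph_prod; have [<- | neij] := eqVneq i j.
  rewrite big1 // => x _; rewrite symdiffE addbb.
  by apply/val_inj.
have [/forallP e | ] := boolP [forall x, (x \in A i) == (x \in A j)].
  by case/eqP: neij; apply/Ainj/setP => x; apply/eqP.
rewrite negb_forall => /existsP[x nex].
by rewrite (bigD1 x) //= symdiffE -negb_eqb nex subrr mul0r.
Qed.

Lemma leq_size_bin : (N <= 2 * 'C(#|T|, d./2))%N.
Proof. by rewrite -{1}(mxrank_int_id_mod2 _ _ sum_mx_mod2) rank_sum_mx. Qed.

End Rank.

Theorem theorem1p5 (n d : nat) (F : {set {set 'I_n}}) (hdn : d <= n)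
    (hunif : uniform_family F)
    (hVdim : Vdim (symdiff_family F F) <= d) :
  #|F| <= 2 * 'C(n, d./2).
Proof.
have [k Fk] := hunif.
(* For [k < d./2], binomials increase from [k] to [d./2] because [2 * d./2 <= d <= n]. *)
have [dk | kd] := leqP d./2 k; last first.
  apply: leq_trans (_ : 'C(n, k) <= _); last first.
    apply: leq_trans (leq_bin2r _ _ _ (ltnW kd) _) _; last by rewrite leq_pmull.
    by apply: leq_trans hdn; rewrite -[leqRHS]odd_double_half leq_addl.
  rewrite -[n in 'C(n, _)]card_ord -card_draws; apply/subset_leq_card/subsetP => B FB.
  by rewrite inE Fk.
have [c cP] := prod_sub1_spanned int _ _ _ hVdim.
rewrite -[n in 'C(n, _)]card_ord.
apply: (leq_size_bin _ _ k d (@enum_val _ (mem F)) _ dk c) => //.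
- by move=> i; apply/Fk/enum_valP.
- exact: enum_val_inj.
by move=> i j; apply: cP; apply: imset2_f; apply: enum_valP.
Qed.
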